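(* Let $A$ and $B$ be evolution algebras over a field $K$ satisfying $\dim(A^2)=\dim(B^2)=1$, $(A^2)^2=A^3=0$ and $(B^2)^2=B^3=0$. Write $A=\mathrm{Ann}(A)\oplus W_A$ and $B=\mathrm{Ann}(B)\oplus W_B$, where $W_A$ and $W_B$ are subspaces that are nondegenerate for the inner products of $A$ and $B$. Then $A$ and $B$ are isomorphic if and only if $\dim(\mathrm{Ann}(A))=\dim(\mathrm{Ann}(B))$ and the spaces $W_A$ and $W_B$ (with the restricted inner products) are isometric.
   Context: An algebra over a field $K$ is a $K$-vector space $A$ with a bilinear product $A\times A\to A$. It is an evolution algebra if it has a basis $\{a_i\}_{i\in I}$ (a natural basis) with $a_ia_j=0$ for all $i\neq j$. $A^2$ denotes the linear span of all products $xy$ with $x,y\in A$; $A^3$ is the span of products of elements of $A^2$ with elements of $A$; $(A^2)^2$ is the span of products of two elements of $A^2$. $\mathrm{Ann}(A)=\{x\in A\mid xA=0\}$. An inner product space over $K$ is a $K$-vector space $V$ with a symmetric bilinear form $\langle\cdot,\cdot\rangle:V\times V\to K$; it is nondegenerate if the only $x\in V$ with $\langle x,V\rangle=0$ is $x=0$, and a subspace is nondegenerate if it is so for the restricted form. Two inner product spaces $(V,\langle\cdot,\cdot\rangle)$ and $(V',\langle\cdot,\cdot\rangle')$ are isometric if there is a linear isomorphism $f:V\to V'$ with $\langle f(x),f(y)\rangle'=\langle x,y\rangle$ for all $x,y\in V$. For an evolution algebra $A$ with $\dim(A^2)=1$, one takes $0\neq a\in A$ with $A^2=Ka$, and the inner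 product of $A$ is the symmetric bilinear form $\langle\cdot,\cdot\rangle:A\times A\to K$ given by $xy=\langle x,y\rangle a$ for all $x,y\in A$. Its radical is $\mathrm{Ann}(A)$. The inner product of $B$ is defined in the same way from $0\neq b\in B$ with $B^2=Kb$.
   Formalization: W_A and W_B are required to be isometric for the given a and some suitable generator b' of B^2, not for the b fixed in advance; with b fixed the ''only if'' fails (over the reals: A=B=span(e,n), e^2=n, a=n, b=-n). *)

(* Defs.v *)
From HB Require Import structures.
From mathcomp Require Import all_boot all_order all_algebra.
From mathcomp Require Import sesquilinear.
From mathcomp Require Import boolp classical_sets functions cardinality.
Set Implicit Arguments.
Unset Strict Implicit.
Unset Printing Implicit Defensive.
Import GRing.Theory.
Local Open Scope ring_scope.
Local Open Scope classical_set_scope.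
Local Open Scope card_scope.

(* An algebra over K is an lmodType A together with a product
   mul : {bilinear A -> A -> A}; no associativity, commutativity, unit or
   dimension assumption is made. Subspaces are sets W : set A satisfying
   GRing.submod_closed, and dimensions are compared as cardinals of bases. *)

Section Subspaces.
Variables (K : fieldType) (V : lmodType K).

Definition lspan (S : set V) : set V :=
  [set x | exists (n : nat) (c : 'I_n -> K) (v : 'I_n -> V),
      (forall i, S (v i)) /\ x = \sum_(i < n) c i *: v i].

Definition line (a : V) : set V := [set k *: a | k in [set: K]].

Definition lin_indep (S : set V) : Prop :=
  forall (n : nat) (v : 'I_n -> V) (c : 'I_n -> K),
    injective v -> (forall i, S (v i)) ->
    \sum_(i < n) c i *: v i = 0 -> forall i, c i = 0.

Definition is_basis (U X : set V) : Prop := lspan X = U /\ lin_indep X.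

Definition dim_is (U : set V) (n : nat) : Prop :=
  exists X : set V, is_basis U X /\ X #= `I_n.

Definition is_subspace (W : set V) : Prop := GRing.submod_closed [in W].

Definition direct_sum (U W : set V) : Prop :=
  [set u + w | u in U & w in W] = [set: V] /\ U `&` W = [set 0].

Definition nondegenerate_on (g : V -> V -> K) (W : set V) : Prop :=
  forall x, W x -> (forall y, W y -> g x y = 0) -> x = 0.

End Subspaces.

Definition eq_dim (K : fieldType) (V V' : lmodType K)
    (U : set V) (U' : set V') : Prop :=
  exists (X : set V) (X' : set V'),
    [/\ is_basis U X, is_basis U' X' & X #= X'].

(* Only the restriction of f to W is constrained; its values outside of W are
   irrelevant. *)
Definition isometric_on (K : fieldType) (V V' : lmodType K)
    (g : V -> V -> K) (W : set V) (g' : V' -> V' -> K) (W' : set V') : Prop :=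
  exists f : V -> V',
    [/\ forall (k : K) x y, W x -> W y -> f (k *: x + y) = k *: f x + f y,
        set_bij W W' f
      & forall x y, W x -> W y -> g' (f x) (f y) = g x y].

Section Algebras.
Variables (K : fieldType) (A : lmodType K) (mul : {bilinear A -> A -> A}).

(* Natural bases are given as sets of vectors, hence of any cardinality. *)
Definition evolution_algebra : Prop :=
  exists X : set A, is_basis [set: A] X /\
    forall x y, X x -> X y -> x <> y -> mul x y = 0.

Definition prod_span (S T : set A) : set A :=
  lspan [set mul x y | x in S & y in T].

Definition alg_sq : set A := prod_span [set: A] [set: A].
Definition alg_cube : set A := prod_span alg_sq [set: A].
Definition alg_sq_sq : set A := prod_span alg_sq alg_sq.

Definition Ann : set A := [set x | forall y, mul x y = 0].

Definition sq_generator (a : A) : Prop := a != 0 /\ alg_sq = line a.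

(* The inner product <x, y> of the algebra relative to a generator a of A^2:
   the scalar k with x y = k a, which exists and is unique when
   sq_generator a holds (see innerpE). *)
Definition innerp (a x y : A) : K := xget 0 [set k | mul x y = k *: a].

Lemma innerpE (a x y : A) : sq_generator a -> mul x y = innerp a x y *: a.
Proof.
case=> _ sqE; rewrite /innerp.
have : alg_sq (mul x y).
  exists 1%N, (fun=> 1), (fun=> mul x y); split.
    by move=> _; exists x => //; exists y.
  by rewrite big_ord1 scale1r.
rewrite sqE => -[k _ kE].
by case: xgetP => [c _ //|/(_ k)/=]; rewrite kE.
Qed.

End Algebras.

Definition alg_isomorphic (K : fieldType) (A B : lmodType K)
    (mulA : {bilinear A -> A -> A}) (mulB : {bilinear B -> B -> B}) : Prop :=
  exists f : {linear A -> B},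
    bijective f /\ forall x y, f (mulA x y) = mulB (f x) (f y).

(* Main.v *)
From HB Require Import structures.
Require Import Defs.
From mathcomp Require Import all_boot all_order all_algebra.
From mathcomp Require Import sesquilinear.
From mathcomp Require Import boolp classical_sets functions cardinality.
Set Implicit Arguments.
Unset Strict Implicit.
Unset Printing Implicit Defensive.
Import GRing.Theory.
Local Open Scope ring_scope.
Local Open Scope classical_set_scope.

(** Modulo its annihilator, such an algebra is its inner product: a product
    depends only on the classes of its factors modulo [Ann], and equals their
    inner product times the generator of the square. The complement [W] is a
    model of the quotient by [Ann], so the algebra is recovered from three
    data: the vector space [Ann], the inner product space [W], and the place in
    [Ann] of the generator. That generator does lie in [Ann], because the cube
    is zero.

    An isomorphism [f] maps [Ann mulA] onto [Ann mulB] and [a] to a generator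
    [f a] of the square of [B]. It need not map [WA] into [WB], but following
    it by the projection onto [WB] along [Ann mulB] changes no product, and
    this gives the isometry for the generator [f a] ([iso_isometric]). Bases of
    the annihilators must also be exhibited: in an evolution algebra the
    elements of a natural basis with zero square form one ([Ann_basis]), and
    [f] carries it to a basis of the other annihilator.

    Conversely, a linear bijection between the annihilators and an isometry
    between the complements glue to a linear bijection ([direct_sum_glue]). It
    preserves products as soon as it maps [a] to [b'], and this can be imposed
    because [a] and [b'] are nonzero vectors of the annihilators: the linear
    automorphisms of a space act transitively on its nonzero vectors, already
    through perturbations of the identity of rank at most one ([transvection],
    [eq_dim_linear_bij_point]). *)

(** * Subspaces and maps that are linear on a subspace *)

Section LinearOnSubspaces.
Variables (K : fieldType) (V V' : lmodType K).
Implicit Types U : set V.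

Lemma subspace0 U : is_subspace U -> U 0.
Proof. by case; rewrite inE. Qed.

Lemma subspaceP U k x y : is_subspace U -> U x -> U y -> U (k *: x + y).
Proof. by case=> _ UP Ux Uy; have := UP k x y; rewrite !inE; apply. Qed.

Lemma subspaceZ U k x : is_subspace U -> U x -> U (k *: x).
Proof.
by move=> sU Ux; rewrite -[_ *: _]addr0; apply: subspaceP => //; exact: subspace0.
Qed.

Lemma subspaceD U x y : is_subspace U -> U x -> U y -> U (x + y).
Proof. by move=> sU Ux Uy; rewrite -[x]scale1r; exact: subspaceP. Qed.

Lemma subspaceB U x y : is_subspace U -> U x -> U y -> U (x - y).
Proof. by move=> sU Ux Uy; rewrite addrC -scaleN1r; exact: subspaceP. Qed.

Definition linear_on U (f : V -> V') : Prop :=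
  forall (k : K) x y, U x -> U y -> f (k *: x + y) = k *: f x + f y.

End LinearOnSubspaces.

(** * Linear combinations and the universal property of a basis *)

Section LinearCombinations.
Variables (K : fieldType) (V : lmodType K).
Implicit Types (U X : set V) (s : seq (K * V)).

(** The combination is read through an arbitrary map [h], so that one list of
    coefficients and vectors [s] stands both for a vector of [V] ([h := id])
    and for its candidate image under a linear map extending [h]. *)
Definition lincomb (V' : lmodType K) (h : V -> V') s : V' :=
  \sum_(p <- s) p.1 *: h p.2.

Definition coef s x : K := \sum_(p <- s | p.2 == x) p.1.

Definition supported s X : Prop := {in s, forall p, X p.2}.

Lemma lincomb_cat (V' : lmodType K) (h : V -> V') (k : K) s t :
  lincomb h ([seq (k * p.1, p.2) | p <- s] ++ t) =
  k *: lincomb h s + lincomb h t.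
Proof.
rewrite /lincomb big_cat big_map scaler_sumr; congr (_ + _).
by apply: eq_bigr => p _; rewrite scalerA.
Qed.

Lemma supported_cat X (k : K) s t : supported s X -> supported t X ->
  supported ([seq (k * p.1, p.2) | p <- s] ++ t) X.
Proof.
move=> sX tX p; rewrite mem_cat => /orP[/mapP[q qs ->]|pt].
  exact: (sX q qs).
exact: tX.
Qed.

(** Vectors may be repeated in [s]; grouping the equal ones gives distinct
    vectors, to which linear independence applies. *)
Lemma lincomb_coef (V' : lmodType K) (h : V -> V') s :
  lincomb h s = \sum_(x <- undup (map snd s)) coef s x *: h x.
Proof.
under [RHS]eq_bigr => x _ do rewrite scaler_suml.
rewrite (exchange_big_dep predT)//= /lincomb big_seq [RHS]big_seq.
apply: eq_bigr => p ps.
have ps2 : p.2 \in undup (map snd s) by rewrite mem_undup map_f.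
rewrite big_mkcond (bigD1_seq p.2) ?undup_uniq//= eqxx big1 ?addr0// => x.
by rewrite eq_sym => /negPf ->.
Qed.

Lemma supported_undup s X x :
  supported s X -> x \in undup (map snd s) -> X x.
Proof. by move=> sX; rewrite mem_undup => /mapP[p ps ->]; exact: sX. Qed.

Lemma lspanP X x :
  lspan X x <-> exists2 s, supported s X & x = lincomb id s.
Proof.
split=> [[n [c [v [vX ->]]]]|[s sX ->]].
  exists [seq (c i, v i) | i <- index_enum 'I_n].
    by move=> p /mapP[i _ ->]; exact: vX.
  by rewrite /lincomb big_map.
exists (size s), (fun i => (tnth (in_tuple s) i).1).
exists (fun i => (tnth (in_tuple s) i).2); split.
  by move=> i; apply: sX; exact: mem_tnth.
by rewrite /lincomb big_tnth.
Qed.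

Lemma lin_indep_uniq X (r : seq V) (c : V -> K) : lin_indep X -> uniq r ->
  {in r, forall x, X x} -> \sum_(x <- r) c x *: x = 0 ->
  {in r, forall x, c x = 0}.
Proof.
move=> indX r_uniq rX r0 x xr.
have xi : (index x r < size r)%N by rewrite index_mem.
have := indX _ (tnth (in_tuple r)) (fun i => c (tnth (in_tuple r) i)).
move=> /(_ _ _ _ (Ordinal xi)); rewrite !(tnth_nth x) /= nth_index //.
apply.
- move=> i j; rewrite !(tnth_nth x) => /uniqP; move=> /(_ r_uniq) E.
  by apply/val_inj/E; rewrite inE /=.
- by move=> i; apply: rX; exact: mem_tnth.
- by rewrite -[RHS]r0 [RHS]big_tnth.
Qed.

(** Linear relations between elements of an independent set are trivial, hence
    are respected by any map. This makes extension by linearity well defined. *)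
Lemma lin_indep_lincomb0 X s (V' : lmodType K) (h : V -> V') :
  lin_indep X -> supported s X -> lincomb id s = 0 -> lincomb h s = 0.
Proof.
move=> indX sX s0; rewrite lincomb_coef big_seq big1 // => x xs.
rewrite (@lin_indep_uniq X (undup (map snd s)) (coef s)) ?scale0r ?undup_uniq //.
  by move=> y; exact: supported_undup.
by rewrite -lincomb_coef.
Qed.

Lemma lspan_subspace X : is_subspace (lspan X).
Proof.
split; first by rewrite inE; apply/lspanP; exists [::]; rewrite // /lincomb big_nil.
move=> k x y; rewrite !inE => /lspanP[s sX ->] /lspanP[t tX ->].
apply/lspanP; exists ([seq (k * p.1, p.2) | p <- s] ++ t).
  exact: supported_cat.
by rewrite lincomb_cat.
Qed.

Lemma lspan_sub X U : is_subspace U -> X `<=` U -> lspan X `<=` U.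
Proof.
move=> sU XU x /lspanP[s sX ->]; rewrite /lincomb big_seq.
apply: (big_ind U) => [|y z|p ps]; first exact: subspace0.
- exact: subspaceD.
- by apply: subspaceZ => //; apply/XU/sX.
Qed.

Lemma sub_lspan X : X `<=` lspan X.
Proof.
move=> x Xx; apply/lspanP; exists [:: (1, x)].
  by move=> p; rewrite inE => /eqP ->.
by rewrite /lincomb big_seq1 scale1r.
Qed.

Section LinearOn.
Variables (V' : lmodType K) (U : set V) (f : V -> V').
Hypotheses (subU : is_subspace U) (linf : linear_on U f).

Lemma linear_on0 : f 0 = 0.
Proof.
have U0 := subspace0 subU.
by apply: (addIr (f 0)); rewrite -{1}[f 0]scale1r -linf// scale1r !add0r.
Qed.

Lemma linear_on_lincomb s : supported s U -> f (lincomb id s) = lincomb f s.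
Proof.
elim: s => [_|p s IHs sU]; first by rewrite /lincomb !big_nil linear_on0.
have pU : U p.2 by apply: sU; rewrite mem_head.
have {}sU : supported s U by move=> q qs; apply: sU; rewrite inE qs orbT.
rewrite /lincomb !big_cons linf ?IHs //.
by apply: (lspan_sub subU (@subset_refl _ U)); apply/lspanP; exists s.
Qed.

End LinearOn.

(** The value at [x] is [lincomb h s] for any expression of [x] as
    [lincomb id s]; by [lin_indep_lincomb0] it does not depend on [s]. *)
Lemma linear_extension (V' : lmodType K) U X (h : V -> V') : is_basis U X ->
  exists2 f : V -> V', linear_on U f & {in X, f =1 h}.
Proof.
case=> <- indX.
pose f x := xget 0 [set y | exists s,
  [/\ supported s X, x = lincomb id s & y = lincomb h s]].
have fE s : supported s X -> f (lincomb id s) = lincomb h s.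
  move=> sX; rewrite /f; case: xgetP => [_ _ [t [tX st ->]]|]; last first.
    by move=> /(_ (lincomb h s)) []; exists s.
  (* Two expressions of the same vector differ by a relation. *)
  apply/eqP; rewrite -subr_eq0 addrC -scaleN1r -lincomb_cat.
  apply/eqP/(lin_indep_lincomb0 h indX); first exact: supported_cat.
  by rewrite lincomb_cat scaleN1r st addNr.
exists f => [k x y /lspanP[s sX ->] /lspanP[t tX ->]|x].
  by rewrite -lincomb_cat !fE -?lincomb_cat//; exact: supported_cat.
rewrite inE => Xx; have := fE [:: (1, x)]; rewrite /lincomb !big_seq1 !scale1r.
by apply=> p; rewrite inE => /eqP ->.
Qed.

(** * Moving a nonzero vector to another one *)

(** A nonzero vector has a nonzero coordinate in the basis, and a multiple of
    that coordinate functional is [l]. *)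
Lemma separating_functional U X c : is_basis U X -> U c -> c != 0 ->
  exists2 l : V -> K^o, linear_on U l & l c = 1.
Proof.
move=> bX; have [spanX indX] := bX.
have sU : is_subspace U by rewrite -spanX; exact: lspan_subspace.
have XU : X `<=` U by rewrite -spanX; exact: sub_lspan.
rewrite -{1}spanX => /lspanP[s sX cE] c0.
have [x xs cx] : exists2 x, x \in undup (map snd s) & coef s x != 0.
  apply: contrapT => Hx; case/eqP: c0; rewrite cE lincomb_coef big_seq big1//.
  move=> x xs; have [->|sx0] := eqVneq (coef s x) 0; first exact: scale0r.
  by case: Hx; exists x.
have [l linl lE] := linear_extension (fun y => (y == x)%:R / coef s x : K^o) bX.
exists l => //; rewrite cE (linear_on_lincomb sU linl); last first.
  by move=> p /sX; exact: XU.
rewrite lincomb_coef (bigD1_seq x) ?undup_uniq//= big_seq_cond big1.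
  rewrite addr0 lE ?inE ?eqxx ?mul1r; last exact: supported_undup xs.
  exact: divff.
move=> y /andP[ys yx]; rewrite lE ?inE; last exact: supported_undup ys.
by rewrite (negPf yx) mul0r scaler0.
Qed.

(** Take functionals with [l c = 1] and [m d = 1]. If [l d] is nonzero, [l]
    works; if [m c] is nonzero, so does a multiple of [m]; otherwise
    [l d = 0] and [m c = 0], and the sum of [l] and [m] works. *)
Lemma common_functional U X c d : is_basis U X ->
  U c -> c != 0 -> U d -> d != 0 ->
  exists l : V -> K^o, [/\ linear_on U l, l c = 1 & l d != 0].
Proof.
move=> bX Uc c0 Ud d0.
have [l linl lc] := separating_functional bX Uc c0.
have [m linm md] := separating_functional bX Ud d0.
have [ld|] := eqVneq (l d) 0; last by exists l.
have [mc|mc] := eqVneq (m c) 0.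
  exists (fun x => l x + m x); split; rewrite ?lc ?mc ?ld ?md ?addr0 ?add0r ?oner_neq0 //.
  by move=> k x y Ux Uy; rewrite linl// linm// scalerDr addrACA.
exists (fun x => (m c)^-1 *: m x); split.
- by move=> k x y Ux Uy; rewrite linm// scalerDr; congr (_ + _); exact: mulrCA.
- exact: mulVf.
- by rewrite md; apply: mulf_neq0; rewrite ?invr_eq0 ?oner_neq0.
Qed.

(** With [l] as in [common_functional], take [t x = x + l x *: (d - c)]. Since
    [l (t x) = l x * l d] and [l d] is nonzero, [x] is recovered from [t x]. *)
Lemma transvection U X c d : is_basis U X -> U c -> c != 0 -> U d -> d != 0 ->
  exists2 t : V -> V, linear_on U t /\ set_bij U U t & t c = d.
Proof.
move=> bX Uc c0 Ud d0; have [l [linl lc ld]] := common_functional bX Uc c0 Ud d0.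
have sU : is_subspace U by rewrite -bX.1; exact: lspan_subspace.
have Ue : U (d - c) by exact: subspaceB.
have stepU k x : U x -> U (x + k *: (d - c)).
  by move=> Ux; rewrite addrC; exact: subspaceP.
have le k x : U x -> l (x + k *: (d - c)) = l x + k * (l d - 1).
  move=> Ux; rewrite addrC (linl k) // addrC; congr (_ + k * _).
  by rewrite addrC -scaleN1r (linl (-1)) // lc scaleN1r addrC.
exists (fun x => x + l x *: (d - c)); last by rewrite lc scale1r addrC subrK.
have key x : U x -> l (x + l x *: (d - c)) = l x * l d.
  by move=> Ux; rewrite le // mulrBr mulr1 addrC subrK.
split.
  move=> k x y Ux Uy; rewrite linl // scalerDl [k *: (x + _)]scalerDr addrACA.
  by congr (_ + (_ + _)); rewrite scalerA.
split=> [x Ux|x y|y Uy]; first exact: stepU.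
- rewrite !inE => Ux Uy xy.
  have lxy : l x = l y by apply: (mulIf ld); rewrite -!key// xy.
  by move: xy; rewrite lxy => /addIr.
(* The preimage x of y satisfies l x = l y / l d. *)
- exists (y + (- (l y / l d)) *: (d - c)); first exact: stepU.
  rewrite le// mulNr mulrBr mulr1 divfK// opprB addrCA subrr addr0.
  by rewrite scaleNr subrK.
Qed.

End LinearCombinations.

(** * Linear bijections from equality of dimensions *)

Lemma extension_cancel (K : fieldType) (V V' : lmodType K) (U X : set V)
    (U' X' : set V') (f : V -> V') (g : V' -> V) :
    is_basis U X -> is_basis U' X' -> linear_on U f -> linear_on U' g ->
    (forall x, X x -> X' (f x)) -> (forall x, X x -> g (f x) = x) ->
  forall x, U x -> U' (f x) /\ g (f x) = x.
Proof.
move=> [UE _] [U'E _] linf ling fX fK x; rewrite -{1}UE => /lspanP[s sX ->].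
have sU : is_subspace U by rewrite -UE; exact: lspan_subspace.
have sU' : is_subspace U' by rewrite -U'E; exact: lspan_subspace.
pose t := [seq (p.1, f p.2) | p <- s].
have tX' : supported t X' by move=> _ /mapP[p ps ->]; exact/fX/(sX p).
have fE : f (lincomb id s) = lincomb id t.
  rewrite (linear_on_lincomb sU linf) /lincomb ?big_map// => p /sX.
  by rewrite -UE; exact: sub_lspan.
split; first by rewrite fE -U'E; apply/lspanP; exists t.
rewrite fE (linear_on_lincomb sU' ling); last first.
  by move=> p /tX'; rewrite -U'E; exact: sub_lspan.
rewrite /lincomb big_map big_seq [RHS]big_seq.
by apply: eq_bigr => p ps /=; rewrite fK//; exact: sX.
Qed.

(** A bijection of bases and its inverse both extend linearly, and the
    extensions are inverse to each other since they are so on the bases. *)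
Lemma eq_dim_linear_bij (K : fieldType) (V V' : lmodType K)
    (U : set V) (U' : set V') : eq_dim U U' ->
  exists2 f : V -> V', linear_on U f & set_bij U U' f.
Proof.
case=> X [X' [bX bX' XX']].
pose V'p : pointedType := HB.pack (GRing.Lmodule.sort V') (isPointed.Build V' 0).
have [h [hX hI hS]] := @card_set_bijP V V'p X X' XX'.
pose k y := xget 0 [set x | X x /\ h x = y].
have kP y : X' y -> X (k y) /\ h (k y) = y.
  move=> /hS[x Xx xy]; rewrite /k; case: xgetP => [_ -> //|/(_ x) []].
  by split.
have hK x : X x -> k (h x) = x.
  by move=> Xx; have [Xk] := kP _ (hX _ Xx); apply: hI; rewrite inE.
have [f linf fE] := linear_extension (h : V -> V') bX.
have [g ling gE] := linear_extension k bX'.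
have {}fE x : X x -> f x = h x by move=> Xx; rewrite fE ?inE.
have {}gE y : X' y -> g y = k y by move=> Xy; rewrite gE ?inE.
have fK x : U x -> U' (f x) /\ g (f x) = x.
  apply: (extension_cancel bX bX' linf ling) => y Xy; rewrite fE//.
    exact: hX.
  by rewrite gE ?hK//; exact: hX.
have gK y : U' y -> U (g y) /\ f (g y) = y.
  apply: (extension_cancel bX' bX ling linf) => z Xz; rewrite gE//.
    by have [] := kP _ Xz.
  by have [Xk hk] := kP _ Xz; rewrite fE.
exists f => //; split=> [x /fK[]//|x y|y /gK[Ug fg]]; last by exists (g y).
rewrite !inE => /fK[_ fx] /fK[_ fy] fxy.
by rewrite -fx fxy fy.
Qed.

Lemma eq_dim_linear_bij_point (K : fieldType) (V V' : lmodType K)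
    (U : set V) (U' : set V') c d :
    eq_dim U U' -> U c -> c != 0 -> U' d -> d != 0 ->
  exists f : V -> V', [/\ linear_on U f, set_bij U U' f & f c = d].
Proof.
move=> UU' Uc c0 U'd d0.
have [f linf bijf] := eq_dim_linear_bij UU'.
have [X [X' [bX bX' _]]] := UU'.
have sU : is_subspace U by rewrite -bX.1; exact: lspan_subspace.
have [fU fI _] := bijf.
have fc0 : f c != 0.
  apply: contra_neq c0 => fc; apply: fI; rewrite ?inE//; first exact: subspace0.
  by rewrite fc (linear_on0 sU linf).
have [t [lint bijt] tc] := transvection bX' (fU _ Uc) fc0 U'd d0.
exists (t \o f); split=> //; last exact: set_bij_comp bijf bijt.
move=> k x y Ux Uy /=; rewrite linf// lint//; exact: fU.
Qed.

(** * Direct sums *)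

Section DirectSum.
Variables (K : fieldType) (V : lmodType K) (U W : set V).
Hypotheses (subU : is_subspace U) (subW : is_subspace W).
Hypothesis sumUW : direct_sum U W.

Lemma direct_sum_cap0 x : U x -> W x -> x = 0.
Proof.
by move=> Ux Wx; have : (U `&` W) x by []; rewrite sumUW.2.
Qed.

Lemma direct_sum_proj : exists p : V -> V,
  [/\ linear p, forall x, W (p x), forall x, U (x - p x),
      forall x, U x -> p x = 0 & forall x, W x -> p x = x].
Proof.
have /choice[p pP] : forall x, exists w, W w /\ U (x - w).
  move=> x; have : [set: V] x by []; rewrite -sumUW.1 => -[u Uu [w Ww <-]].
  by exists w; rewrite addrK.
have uniqp x w : W w -> U (x - w) -> p x = w.
  move=> Ww Uxw; have [Wp Up] := pP x; apply/eqP; rewrite -subr_eq0; apply/eqP.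
  apply: direct_sum_cap0; last exact: subspaceB.
  have -> : p x - w = (x - w) - (x - p x).
    by rewrite opprB [RHS]addrC addrA subrK.
  exact: subspaceB.
exists p; split=> [k x y|x|x|x Ux|x Wx].
- have [[Wx Ux] [Wy Uy]] := (pP x, pP y).
  apply: uniqp; first exact: subspaceP.
  by rewrite opprD addrACA -scalerBr; exact: subspaceP.
- by have [] := pP x.
- by have [] := pP x.
- by apply: uniqp; rewrite ?subr0//; exact: subspace0.
- by apply: uniqp; rewrite ?subrr//; exact: subspace0.
Qed.

End DirectSum.

(** The glued map sends [u + w] to [f u + g w]; if this is zero, then [f u] lies
    in both [U'] and [W'], so [f u] and [g w] are zero, and injectivity on the
    two summands suffices. *)
Lemma direct_sum_glue (K : fieldType) (V V' : lmodType K) (U W : set V)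
    (U' W' : set V') (f g : V -> V') :
    is_subspace U -> is_subspace W -> direct_sum U W ->
    is_subspace U' -> is_subspace W' -> direct_sum U' W' ->
    linear_on U f -> set_bij U U' f -> linear_on W g -> set_bij W W' g ->
  exists h : {linear V -> V'},
    [/\ bijective h, {in U, h =1 f} & {in W, h =1 g}].
Proof.
move=> sU sW sumUW sU' sW' sumUW' linf [fU fI fS] ling [gW gI gS].
have [p [linp Wp Up p0 pid]] := direct_sum_proj sU sW sumUW.
pose h x := f (x - p x) + g (p x).
have linh : linear h.
  move=> k x y; rewrite /h linp opprD addrACA -scalerBr linf// ling//.
  by rewrite scalerDr addrACA.
have f0 := linear_on0 sU linf; have g0 := linear_on0 sW ling.
pose hL : {linear V -> V'} := HB.pack h (GRing.isLinear.Build _ _ _ _ h linh).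
have hU x : U x -> h x = f x by move=> Ux; rewrite /h p0// g0 subr0 addr0.
have hW x : W x -> h x = g x by move=> Wx; rewrite /h pid// subrr f0 add0r.
exists hL; split=> [|x|x]; [|by rewrite inE => /hU|by rewrite inE => /hW].
rewrite -setTT_bijective; split=> // [x y _ _ hxy|y _].
  suff h0 z : h z = 0 -> z = 0.
    apply/eqP; rewrite -subr_eq0; apply/eqP/h0.
    by rewrite -[h _]/(hL _) raddfB; apply/eqP; rewrite subr_eq0; apply/eqP.
  rewrite {1}/h => hz0.
  have fz : f (z - p z) = 0.
    apply: (direct_sum_cap0 sumUW'); first exact/fU/Up.
    have -> : f (z - p z) = 0 - g (p z) by rewrite -hz0 addrK.
    by apply: subspaceB => //; [exact: subspace0|exact/gW/Wp].
  have pz : p z = 0.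
    apply: gI; rewrite ?inE//; first exact: subspace0.
    by move: hz0; rewrite fz add0r g0.
  rewrite pz subr0 in fz; apply: fI; rewrite ?inE ?f0//; last exact: subspace0.
  by rewrite -[z]subr0 -pz.
have : [set: V'] y by []; rewrite -sumUW'.1 => -[u' U'u [w' W'w <-]].
have [u Uu <-] := fS _ U'u; have [w Ww <-] := gS _ W'w.
by exists (u + w) => //; rewrite -[LHS]/(hL (u + w)) raddfD /= hU// hW.
Qed.

(** * Image of a basis *)

Lemma is_basis_image (K : fieldType) (V V' : lmodType K) (U X : set V)
    (f : {linear V -> V'}) : injective f -> is_basis U X ->
  is_basis (f @` U) (f @` X).
Proof.
move=> f_inj [<- indX]; split.
  apply/seteqP; split=> [_ [n [c [v [vX ->]]]]|_ [_ [n [c [v [vX ->]]]] <-]].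
    have /choice[w wP] : forall i, exists x, X x /\ f x = v i.
      by move=> i; have [x] := vX i; exists x.
    exists (\sum_(i < n) c i *: w i).
      by exists n, c, w; split=> // i; have [] := wP i.
    by rewrite linear_sum; apply: eq_bigr => i _; rewrite linearZ /= (wP i).2.
  exists n, c, (f \o v); split; first by move=> i; exists (v i).
  by rewrite linear_sum; apply: eq_bigr => i _; rewrite linearZ.
move=> n v c v_inj vX v0.
have /choice[w wP] : forall i, exists x, X x /\ f x = v i.
  by move=> i; have [x] := vX i; exists x.
apply: (indX n w c) => [i j wij|i|].
- by apply: v_inj; rewrite -(wP i).2 -(wP j).2 wij.
- by have [] := wP i.
- apply: f_inj; rewrite linear0 -[RHS]v0 linear_sum.
  by apply: eq_bigr => i _; rewrite linearZ /= (wP i).2.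
Qed.

(** * The annihilator and the square of an evolution algebra *)

Section EvolutionAlgebra.
Variables (K : fieldType) (A : lmodType K) (mul : {bilinear A -> A -> A}).

Lemma Ann_subspace : is_subspace (Ann mul).
Proof.
split; first by rewrite inE => y; rewrite linear0l.
move=> k x x'; rewrite !inE => xA x'A y.
by rewrite linearPl xA x'A scaler0 addr0.
Qed.

(** Two elements of a natural basis are equal or have zero product in both
    orders, so they commute; this extends to their span in each argument. *)
Lemma evolution_mulC : evolution_algebra mul -> forall x y, mul x y = mul y x.
Proof.
case=> X [[spanX _] X0].
have commS x : is_subspace [set y | mul x y = mul y x].
  split; first by rewrite inE /= linear0l linear0r.
  by move=> k y z; rewrite !inE /= linearPl linearPr => -> ->.
have X_comm x y : X x -> mul x y = mul y x.
  move=> Xx; have: lspan X `<=` [set y | mul x y = mul y x]; last first.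
    by apply; rewrite spanX.
  apply: (lspan_sub (commS x)) => z Xz.
  have [->//|/eqP xz] := eqVneq x z.
  by rewrite /= !X0//; exact: nesym.
move=> x y; have: lspan X `<=` [set y | mul x y = mul y x]; last first.
  by apply; rewrite spanX.
by apply: (lspan_sub (commS x)) => z Xz; rewrite /= -(X_comm z).
Qed.

(** If [x] is a combination of a natural basis, then [mul x y] for [y] in that
    basis is the [y]-coordinate of [x] times [mul y y]. Hence [x] annihilates
    the algebra exactly when its coordinates vanish outside of the elements of
    zero square, and these form the basis. *)
Lemma Ann_basis : evolution_algebra mul -> exists X, is_basis (Ann mul) X.
Proof.
case=> X [[spanX indX] X0]; exists [set x | X x /\ mul x x = 0]; split.
  apply/seteqP; split.
    apply: lspan_sub; first exact: Ann_subspace.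
    move=> x [Xx xx] y; have : [set: A] y by []; rewrite -spanX.
    move=> /lspanP[s sX ->]; rewrite /lincomb linear_sumr big_seq big1//.
    move=> p ps; rewrite linearZr_LR /=.
    have [<-|/eqP xp] := eqVneq x p.2; first by rewrite xx scaler0.
    by rewrite X0 ?scaler0//; exact: sX.
  move=> x xA; have : [set: A] x by []; rewrite -spanX => /lspanP[s sX xE].
  rewrite lincomb_coef in xE; set r := undup _ in xE.
  have rX y : y \in r -> X y by exact: supported_undup.
  have coefsq y : y \in r -> coef s y *: mul y y = 0.
    move=> yr; rewrite -(xA y) xE linear_sumlz (bigD1_seq y) ?undup_uniq//=.
    rewrite linearZl_LR big_seq_cond big1 ?addr0// => z /andP[zr /eqP zy].
    by rewrite linearZl_LR /= X0 ?scaler0//; exact: rX.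
  pose S := [set x | X x /\ mul x x = 0].
  move: (lspan_subspace S) (@sub_lspan _ _ S); rewrite -/S.
  move: (lspan S) => N subN SN; rewrite xE big_seq; apply: (big_ind N).
  - exact: subspace0.
  - by move=> y z; exact: subspaceD.
  - move=> y yr; have [->|cy] := eqVneq (coef s y) 0.
      by rewrite scale0r; exact: subspace0.
    apply: subspaceZ => //; apply: SN; split; first exact: rX.
    by have /eqP := coefsq _ yr; rewrite scaler_eq0 (negPf cy) => /eqP.
by move=> n v c v_inj vX; apply: indX => // i; have [] := vX i.
Qed.

Lemma sq_generator_Ann a :
  alg_cube mul = [set 0] -> sq_generator mul a -> Ann mul a.
Proof.
move=> A3 [_ A2E] y; have : alg_cube mul (mul a y); last by rewrite A3.
apply: sub_lspan; exists a; last by exists y.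
by rewrite A2E; exists 1; rewrite // scale1r.
Qed.

(** [Ann] is defined by products on the left; commutativity is what allows the
    second factor to be changed as well. *)
Lemma mul_modAnn : evolution_algebra mul -> forall x y x' y',
  Ann mul (x - x') -> Ann mul (y - y') -> mul x y = mul x' y'.
Proof.
move=> evo x y x' y' xA yA.
have -> : mul x y = mul x' y.
  by apply/eqP; rewrite -subr_eq0 -linearBl xA.
rewrite ![mul x' _](evolution_mulC evo).
by apply/eqP; rewrite -subr_eq0 -linearBl yA.
Qed.

Lemma innerp_eq a x y k : sq_generator mul a ->
  mul x y = k *: a -> innerp mul a x y = k.
Proof.
move=> genA; rewrite (innerpE _ _ genA) => /eqP.
by rewrite -subr_eq0 -scalerBl scaler_eq0 (negPf genA.1) orbF subr_eq0 => /eqP.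
Qed.

End EvolutionAlgebra.

(** * Isomorphisms against isometries *)

Section Isomorphism.
Variables (K : fieldType) (A B : lmodType K).
Variables (mulA : {bilinear A -> A -> A}) (mulB : {bilinear B -> B -> B}).
Hypotheses (evoA : evolution_algebra mulA) (evoB : evolution_algebra mulB).

Lemma iso_sq_generator (f : {linear A -> B}) a : bijective f ->
  (forall x y, f (mulA x y) = mulB (f x) (f y)) ->
  sq_generator mulA a -> sq_generator mulB (f a).
Proof.
move=> f_bij fM genA; have [g fK gK] := f_bij; have [a0 A2E] := genA.
split; first by rewrite -(linear0 f) (inj_eq (bij_inj f_bij)).
apply/seteqP; split=> [_ [n [c [v [vM ->]]]]|_ [k _ <-]].
  apply: (big_ind (line (f a))).
  - by exists 0; rewrite // scale0r.
  - by move=> _ _ [k _ <-] [l _ <-]; exists (k + l); rewrite // scalerDl.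
  - move=> i _; have [x _ [y _ <-]] := vM i; rewrite -[x]gK -[y]gK -fM.
    rewrite (innerpE _ _ genA) linearZ /= scalerA.
    by exists (c i * innerp mulA a (g x) (g y)).
have : alg_sq mulA (k *: a) by rewrite A2E; exists k.
rewrite /= -linearZ /=.
move=> [n [c [v [vM ->]]]]; exists n, c, (f \o v); split=> [i|].
  rewrite /=; have [x _ [y _ <-]] := vM i.
  by exists (f x) => //; exists (f y).
by rewrite linear_sum; apply: eq_bigr => i _; rewrite linearZ.
Qed.

Lemma iso_Ann (f : {linear A -> B}) : bijective f ->
  (forall x y, f (mulA x y) = mulB (f x) (f y)) ->
  forall x, Ann mulB (f x) <-> Ann mulA x.
Proof.
move=> f_bij fM x; have [g fK gK] := f_bij; split=> xA y.
  by apply: (bij_inj f_bij); rewrite fM xA linear0.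
by rewrite -[y]gK -fM xA linear0.
Qed.

Lemma iso_eq_dim_Ann : alg_isomorphic mulA mulB ->
  eq_dim (Ann mulA) (Ann mulB).
Proof.
move=> [f [f_bij fM]]; have [X bX] := Ann_basis evoA.
have f_inj := bij_inj f_bij.
have AnnE : Ann mulB = f @` Ann mulA.
  apply/seteqP; split=> [y|_ [x xA <-]]; last exact/iso_Ann.
  have [g fK gK] := f_bij; rewrite -{1}[y]gK => /(iso_Ann f_bij fM) gA.
  by exists (g y).
exists X, (f @` X); split=> //; first by rewrite AnnE; exact: is_basis_image.
by rewrite card_eq_sym; apply: inj_card_eq => x y _ _; exact: f_inj.
Qed.

Variables (WA : set A) (WB : set B).
Hypotheses (subWA : is_subspace WA) (subWB : is_subspace WB).
Hypotheses (sumA : direct_sum (Ann mulA) WA) (sumB : direct_sum (Ann mulB) WB).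

(** The isometry is [p \o f], with [p] the projection onto [WB] along
    [Ann mulB]: as [f x] and [p (f x)] agree modulo [Ann mulB], products are
    the same, and [p \o f] kills only the [x] in [Ann mulA], which meets [WA]
    trivially. *)
Lemma iso_isometric a : sq_generator mulA a -> alg_isomorphic mulA mulB ->
  exists b, sq_generator mulB b /\
    isometric_on (innerp mulA a) WA (innerp mulB b) WB.
Proof.
move=> genA [f [f_bij fM]]; have genB := iso_sq_generator f_bij fM genA.
have fAnn := iso_Ann f_bij fM; have [g fK gK] := f_bij.
exists (f a); split=> //.
have [p [linp WBp Ap p0 pid]] :=
  direct_sum_proj (Ann_subspace mulB) subWB sumB.
pose pL : {linear B -> B} := HB.pack p (GRing.isLinear.Build _ _ _ _ p linp).
exists (p \o f); split=> [k x y _ _||x y _ _] /=.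
- by rewrite linearP linp.
- split=> [x _|x y|y WBy]; first exact: WBp.
    rewrite !inE /= => Wx Wy pxy; apply/eqP; rewrite -subr_eq0; apply/eqP.
    apply: (direct_sum_cap0 sumA); last exact: subspaceB.
    apply/fAnn; have := Ap (f (x - y)).
    by rewrite linearB -[p _]/(pL _) linearB /= pxy subrr subr0.
  (* The preimage of y is the WA-component of f^-1 y: the other component is
     mapped into Ann mulB, which p kills. *)
  have : [set: A] (g y) by []; rewrite -sumA.1 => -[n An [w Ww nw]].
  exists w => //=; have -> : f w = y - f n by rewrite -[y]gK -nw linearD addrC addKr.
  rewrite -[p _]/(pL _) linearB /= pid// p0 ?subr0//; exact/fAnn.
- apply: innerp_eq => //.
  rewrite -(@mul_modAnn _ _ _ evoB (f x) (f y)) // -fM.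
  by rewrite (innerpE _ _ genA) linearZ.
Qed.

(** Let [h] glue the isometry [g] to a bijection [f] of the annihilators with
    [f a = b]. Modulo [Ann], both factors may be taken in [WA]; the product is
    then [innerp mulA a x y *: a], whose image under [h] is the same multiple of
    [b], that is the product of the images since [g] is an isometry. *)
Lemma isometric_iso a b : sq_generator mulA a -> sq_generator mulB b ->
    Ann mulA a -> Ann mulB b -> eq_dim (Ann mulA) (Ann mulB) ->
    isometric_on (innerp mulA a) WA (innerp mulB b) WB ->
  alg_isomorphic mulA mulB.
Proof.
move=> genA genB aA bB dimAB [g [ling bijg gE]].
have [f [linf bijf fab]] :=
  eq_dim_linear_bij_point dimAB aA genA.1 bB genB.1.
have [h [h_bij hA hW]] := direct_sum_glue (Ann_subspace mulA) subWA sumA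
  (Ann_subspace mulB) subWB sumB linf bijf ling bijg.
exists h; split=> // x y.
have [p [_ Wp Ap _ _]] := direct_sum_proj (Ann_subspace mulA) subWA sumA.
have hp z : Ann mulB (h z - h (p z)).
  by rewrite -linearB hA ?inE//; have [fA _ _] := bijf; exact/fA/Ap.
rewrite (mul_modAnn evoB (hp x) (hp y)) (hW (p x)) ?(hW (p y)) ?inE//.
rewrite (innerpE _ _ genB) gE// (mul_modAnn evoA (Ap x) (Ap y)).
by rewrite (innerpE _ _ genA) linearZ /= hA ?inE// fab.
Qed.

End Isomorphism.

Theorem theorem3p22 (K : fieldType) (A B : lmodType K)
    (mulA : {bilinear A -> A -> A}) (mulB : {bilinear B -> B -> B})
    (evoA : evolution_algebra mulA) (evoB : evolution_algebra mulB)
    (dimA2 : dim_is (alg_sq mulA) 1) (dimB2 : dim_is (alg_sq mulB) 1)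
    (A2A2 : alg_sq_sq mulA = [set 0]) (A3 : alg_cube mulA = [set 0])
    (B2B2 : alg_sq_sq mulB = [set 0]) (B3 : alg_cube mulB = [set 0])
    (a : A) (genA : sq_generator mulA a)
    (b : B) (genB : sq_generator mulB b)
    (WA : set A) (subWA : is_subspace WA)
    (sumA : direct_sum (Ann mulA) WA)
    (ndWA : nondegenerate_on (innerp mulA a) WA)
    (WB : set B) (subWB : is_subspace WB)
    (sumB : direct_sum (Ann mulB) WB)
    (ndWB : nondegenerate_on (innerp mulB b) WB) :
  alg_isomorphic mulA mulB <->
  eq_dim (Ann mulA) (Ann mulB) /\
  (* the inner product of B is only defined up to the choice of the generator
     of B^2, so the two inner products are compared for a suitable choice *)
  exists b' : B, sq_generator mulB b' /\
    isometric_on (innerp mulA a) WA (innerp mulB b') WB.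
Proof.
split=> [isoAB|[dimAB [b' [genB' WAB]]]].
  by split; [exact: iso_eq_dim_Ann|exact: iso_isometric].
by apply: (isometric_iso evoA evoB subWA subWB sumA sumB genA genB' _ _ dimAB WAB);
  exact: sq_generator_Ann.
Qed.
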